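(* Let $B\in\mathbb R^{k\times k}$ and let $\Sigma_X,\Sigma_V,W_e\in\mathbb R^{k\times k}$ be symmetric. Assume there is an orthogonal matrix $U$ with $$U^\top\Sigma_XU=\mathrm{diag}(\sigma_1^2,\dots,\sigma_k^2),\quad U^\top\Sigma_VU=\mathrm{diag}(\tau_1^2,\dots,\tau_k^2),\quad U^\top BU=\mathrm{diag}(b_1,\dots,b_k),\quad U^\top W_eU=\mathrm{diag}(w_1,\dots,w_k),$$ with $\sigma_i>0,\tau_i>0,w_i>0$ for all $i$. Let $R\ge0$ and consider the problem of minimizing $\mathrm{tr}(\bar WK_W)$ over symmetric $K_W\in\mathbb R^{2k\times2k}$ subject to $0\preceq K_W\preceq\Sigma_W$ and $\log\det K_W\ge\log\det\Sigma_W-2R$. Then there exists an optimal $K_W^\star(R)$ that, in the basis $\bar U=\mathrm{blkdiag}(U,U)$ and after reordering the $2k$ coordinates into the pairs $(x_i,v_i)$, $i=1,\dots,k$, is block diagonal: $$K_W^\star(R)=\bar U\,\Pi\,\mathrm{blkdiag}\big(K_1^\star(R),\dots,K_k^\star(R)\big)\,\Pi^\top\bar U^\top,$$ with $2\times2$ blocks $K_i^\star(R)=D_i\tilde K_i^\star(R)D_i$, $D_i=\mathrm{diag}(\sigma_i,\tau_i)$, and $$\tilde K_i^\star(R)=R_i\,\mathrm{diag}(\delta_i^\star(R),1)\,R_i^\top,\qquad 0<\delta_i^\star(R)\le1,$$ where $R_i$ is an orthogonal matrix diagonalizing $$A_i=\begin{bmatrix} \tilde w_i\sigma_i^2 & w_i\sigma_i\tau_i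 \\ w_i\sigma_i\tau_i & 0 \end{bmatrix},\qquad\tilde w_i=w_i(2b_i-1),$$ as $R_i^\top A_iR_i=\mathrm{diag}(a_i^+,a_i^-)$ with $a_i^+>0>a_i^-$ and $$a_i^+=\frac12\left(\tilde w_i\sigma_i^2+\sqrt{\tilde w_i^2\sigma_i^4+4w_i^2\sigma_i^2\tau_i^2}\right).$$ The scalars satisfy the waterfilling law $$\delta_i^\star(R)=\min\left\{1,\frac{\eta^\star(R)}{a_i^+}\right\},$$ where $\eta^\star(R)>0$ is chosen so that $\sum_{i=1}^k\log\delta_i^\star(R)=-2R$.
   Context: $\preceq$ is the Loewner order; logarithms are natural. Here $\Sigma_W=\mathrm{blkdiag}(\Sigma_X,\Sigma_V)$ is the covariance of $W=(X,V)$ with $X\sim\mathcal N(0,\Sigma_X)$, $V\sim\mathcal N(0,\Sigma_V)$ independent, and $$\bar W=\begin{bmatrix} \tilde W & W_e \\ W_e & 0 \end{bmatrix},\qquad\tilde W=W_e(B-I)+(B-I)^\top W_e+W_e.$$ The optimization problem is the covariance-design form, at rate $R$, of the encoder's semantic distortion minimization when the encoder observes $(X,\Theta)$ with $\Theta=BX+V$ ($K_W$ is the posterior error covariance of $W$). $\Pi$ is the $2k\times2k$ permutation matrix that sends the paired ordering $(x_1,v_1,x_2,v_2,\dots,x_k,v_k)$ to the ordering $(x_1,\dots,x_k,v_1,\dots,v_k)$. *)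

(* Defs.v *)
From HB Require Import structures.
From mathcomp Require Export all_boot all_order all_algebra.
From mathcomp Require Export reals constructive_ereal exp.

Set Implicit Arguments.
Unset Strict Implicit.
Unset Printing Implicit Defensive.

Import Order.TTheory GRing.Theory Num.Theory.
Local Open Scope ring_scope.

Definition psd (R : realType) (n : nat) (M : 'M[R]_n) : Prop :=
  M^T = M /\ forall v : 'cV[R]_n, 0 <= (v^T *m M *m v) 0 0.

Definition loewner (R : realType) (n : nat) (M N : 'M[R]_n) : Prop :=
  psd (N - M).

Definition orthogonal_mx (R : realType) (n : nat) (M : 'M[R]_n) : Prop :=
  M^T *m M = 1%:M.

Definition blkdiag (R : realType) (m n : nat) (M : 'M[R]_m) (N : 'M[R]_n) :
  'M[R]_(m + n) := block_mx M 0 0 N.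

(* [lne] sends 0 to -oo, so a singular positive semidefinite matrix has
   log-determinant -oo; the real-valued [ln] would send 0 to 0. *)
Definition logdet (R : realType) (n : nat) (M : 'M[R]_n) : \bar R :=
  lne (\det M)%:E.

Section Problem.
Variables (R : realType) (k : nat).
Implicit Types (B SigmaX SigmaV We : 'M[R]_k).

Definition Wtilde B We : 'M[R]_k :=
  We *m (B - 1%:M) + (B - 1%:M)^T *m We + We.

Definition Wbar B We : 'M[R]_(k + k) := block_mx (Wtilde B We) We We 0.

Definition feasible SigmaX SigmaV (rate : R) (KW : 'M[R]_(k + k)) : Prop :=
  let SigmaW := blkdiag SigmaX SigmaV in
  [/\ KW^T = KW, loewner 0 KW, loewner KW SigmaW &
      (logdet SigmaW - (2 * rate)%:E <= logdet KW)%E].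

Definition optimal B SigmaX SigmaV We (rate : R) (KW : 'M[R]_(k + k)) : Prop :=
  feasible SigmaX SigmaV rate KW /\
  forall KW' : 'M[R]_(k + k), feasible SigmaX SigmaV rate KW' ->
    \tr (Wbar B We *m KW) <= \tr (Wbar B We *m KW').

End Problem.

Section Pairing.
Variables (R : realType) (k : nat).

Definition unpair (q : 'I_(\sum_(i < k) 2)) : 'I_(k + k) :=
  if val (tagnat.sig2 q) == 0%N then lshift k (tagnat.sig1 q)
  else rshift k (tagnat.sig1 q).

(* The two spellings of the dimension 2k are kept apart: [\sum_(i < k) 2]
   indexes the ordering (x_1, v_1, ..., x_k, v_k) and is the dimension of
   [\mxdiag_(i < k) K i] for 2 x 2 blocks, while [k + k] indexes
   (x_1, ..., x_k, v_1, ..., v_k). *)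
Definition Pi : 'M[R]_(k + k, \sum_(i < k) 2) :=
  \matrix_(p, q) (p == unpair q)%:R.

End Pairing.

Section TwoByTwo.
Variable R : realType.

Definition mx2 (a b c d : R) : 'M[R]_2 :=
  block_mx (a%:M : 'M_1) (b%:M : 'M_1) (c%:M : 'M_1) (d%:M : 'M_1).

Definition diag2 (a d : R) : 'M[R]_2 := mx2 a 0 0 d.

Definition wtilde (w b : R) : R := w * (2 * b - 1).

Definition Ablock (sigma tau w b : R) : 'M[R]_2 :=
  mx2 (wtilde w b * sigma ^+ 2) (w * sigma * tau) (w * sigma * tau) 0.

Definition aplus (sigma tau w b : R) : R :=
  2^-1 * (wtilde w b * sigma ^+ 2 +
          Num.sqrt (wtilde w b ^+ 2 * sigma ^+ 4 +
                    4 * w ^+ 2 * sigma ^+ 2 * tau ^+ 2)).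

Definition diagonalizes (sigma tau w b : R) (Q : 'M[R]_2) (am : R) : Prop :=
  let ap := aplus sigma tau w b in
  [/\ orthogonal_mx Q, Q^T *m Ablock sigma tau w b *m Q = diag2 ap am,
      0 < ap & am < 0].

End TwoByTwo.

Section PairingFacts.
Variables (R : realType) (k : nat).

Lemma unpair_inj : injective (@unpair k).
Proof.
move=> q q' E.
have nz2 (m n : nat) : m <> 0%N -> n <> 0%N -> (m < 2)%N -> (n < 2)%N -> m = n.
  by case: m => [|[|m]]; case: n => [|[|n]].
have E1 : tagnat.sig1 q = tagnat.sig1 q' /\
          val (tagnat.sig2 q) = val (tagnat.sig2 q').
  move: E; rewrite /unpair.
  have := ltn_ord (tagnat.sig2 q); have := ltn_ord (tagnat.sig2 q').
  case: eqP => [-> | h]; case: eqP => [-> | h'] => L' L.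
  - by move=> /lshift_inj.
  - by move=> /eqP; rewrite eq_lrshift.
  - by move=> /eqP; rewrite eq_rlshift.
  - move=> /rshift_inj ->; split=> //.
    exact: nz2.
case: E1 => E1 E2; rewrite -[q]tagnat.sig2K -[q']tagnat.sig2K.
move: (tagnat.sig2 q) (tagnat.sig2 q') E2; rewrite E1 => u v E2.
by congr (tagnat.Rank _); apply: val_inj.
Qed.

Lemma unpair_Rank (i : 'I_k) (j : 'I_2) :
  unpair (tagnat.Rank (p_ := fun=> 2%N) i j) =
  if val j == 0%N then lshift k i else rshift k i.
Proof. by rewrite /unpair tagnat.Rank2K /= tagnat.Rank1K. Qed.

Lemma trPi_mul_Pi : (Pi R k)^T *m Pi R k = 1%:M.
Proof.
apply/matrixP => q q'; rewrite !mxE (bigD1 (unpair q)) //= [X in _ + X]big1 => [|p pq].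
  by rewrite !mxE eqxx mul1r addr0 (inj_eq unpair_inj).
by rewrite !mxE (negPf pq) mul0r.
Qed.

Lemma Pi_mul_pairs (x v : 'I_k -> R) :
  Pi R k *m
    (\mxcol_(i < k) \col_(j < 2) (if val j == 0%N then x i else v i)) =
  col_mx (\col_i x i) (\col_i v i).
Proof.
apply/matrixP => p z; rewrite ord1 {z} !mxE.
have [q ->] : exists q, p = unpair q.
  case: (split_ordP p) => i ->; first by exists (tagnat.Rank i 0); rewrite unpair_Rank.
  by exists (tagnat.Rank i 1); rewrite unpair_Rank.
rewrite (bigD1 q) //= [X in _ + X]big1 => [|q' qq']; last first.
  by rewrite !mxE (inj_eq unpair_inj) eq_sym (negPf qq') mul0r.
rewrite !mxE eqxx mul1r addr0 /unpair.
case: ifP => _; case: splitP => /= j E.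
- by rewrite mxE; congr x; apply: val_inj.
- by have := ltn_ord (tagnat.sig1 q); rewrite E ltnNge leq_addr.
- by have := ltn_ord j; rewrite -E ltnNge leq_addr.
- by rewrite mxE; congr v; apply: val_inj; move: E => /addnI.
Qed.

End PairingFacts.

(* Main.v *)
(** In the coordinates [K = T M T^T], where [T] is [blkdiag U U] times the
    blocks [D_i R_i], the prior covariance [SigmaW = T T^T] becomes the identity
    and the cost matrix becomes diagonal with entries [c_j], namely the [a_i^+]
    and the [a_i^-]. The problem is then to minimize [sum_j c_j M_jj] over
    [0 <= M <= 1] with [det M >= exp (- 2 rate)]. By Hadamard's inequality only
    the diagonal of [M] matters, and weak duality with the water level [eta] as
    multiplier of the determinant constraint gives the optimum. The level [eta]
    comes from the intermediate value theorem applied to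
    [eta |-> prod_i min (1, eta / a_i^+)]. *)
Require Import Defs.
From mathcomp Require Import all_boot all_order all_algebra.
From mathcomp Require Import reals constructive_ereal exp.
From mathcomp Require Import classical_sets functions topology normedtype.
From mathcomp Require Import sequences realfun.
From mathcomp Require Import ring lra.
Set Implicit Arguments.
Unset Strict Implicit.

Import Order.TTheory GRing.Theory Num.Theory.
Import numFieldNormedType.Exports.
Local Open Scope ring_scope.

(** * Positive semidefinite matrices and Hadamard's inequality *)

Lemma psd_congr (R : realType) (m n : nat) (M : 'M[R]_m) (A : 'M[R]_(m, n)) :
  psd M -> psd (A^T *m M *m A).
Proof.
move=> [symM posM]; split=> [|v]; first by rewrite !trmx_mul trmxK symM !mulmxA.
by have := posM (A *m v); rewrite trmx_mul !mulmxA.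
Qed.

Lemma psd_diag_ge0 (R : realType) (n : nat) (M : 'M[R]_n) (i : 'I_n) :
  psd M -> 0 <= M i i.
Proof.
by move=> [_ /(_ (delta_mx i 0))]; rewrite trmx_delta -rowE -colE !mxE.
Qed.

Lemma psd_diag_mx (R : realType) (n : nat) (d : 'rV[R]_n) :
  (forall i, 0 <= d 0 i) -> psd (diag_mx d).
Proof.
move=> d0; split=> [|v]; first exact: tr_diag_mx.
rewrite mul_mx_diag mxE sumr_ge0 // => i _.
by rewrite !mxE mulrAC -expr2 mulr_ge0 ?sqr_ge0.
Qed.

(** At the vector [(t, b^T)] the quadratic form is affine in [t] with slope twice the squared norm
    of [b], so it can stay nonnegative for all [t] only if [b] vanishes. *)
Lemma psd_zero_corner (R : realType) (n : nat) (b : 'rV[R]_n) (C : 'M[R]_n) :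
  psd (block_mx (0 : 'M_1) b b^T C) -> b = 0.
Proof.
move=> [_ pos].
pose be := (b *m b^T) 0 0; pose ga := (b *m C *m b^T) 0 0.
have quad t : 0 <= 2 * t * be + ga.
  have := pos (col_mx t%:M b^T).
  rewrite tr_col_mx trmxK tr_scalar_mx mul_row_block mulmx0 add0r mul_row_col.
  rewrite mulmxDl mul_mx_scalar mul_scalar_mx -scalemxAl [leRHS]mxE.
  rewrite ![X in X + _]mxE [X in _ + X]mxE -/be -/ga [X in _ + (X + _)]mxE -/be.
  by rewrite addrA -mulrA mulr_natl mulr2n.
have beE : be = \sum_i b 0 i ^+ 2.
  by rewrite /be mxE; apply: eq_bigr => i _; rewrite mxE.
have be0 : be = 0.
  apply/eqP; apply: contraT => ne.
  (* This value of [t] brings the form down to -1. *)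
  have := quad (- (ga + 1) / (2 * be)).
  suff -> : 2 * (- (ga + 1) / (2 * be)) * be + ga = -1 by rewrite ler0N1.
  by field.
apply/rowP => i; rewrite mxE; apply/eqP; rewrite -sqrf_eq0 eq_le sqr_ge0 andbT.
rewrite -be0 beE (bigD1 i) //= lerDl sumr_ge0 // => j _; exact: sqr_ge0.
Qed.

(* The Schur complement of a positive corner is again positive semidefinite and
   has a smaller diagonal; a zero corner forces a zero row. *)
Lemma psd_hadamard (R : realType) (n : nat) (M : 'M[R]_n) :
  psd M -> 0 <= \det M <= \prod_i M i i.
Proof.
elim: n M => [|n IH] M psdM; first by rewrite det_mx00 big_ord0 ler01 lexx.
move: M psdM; rewrite -[n.+1]/(1 + n)%N => M psdM.
set s := M (lshift n 0) (lshift n 0).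
have s0 : 0 <= s by apply: psd_diag_ge0.
set b := ursubmx M; set C := drsubmx M.
have ulM : ulsubmx M = s%:M by apply/matrixP => i j; rewrite !ord1 !mxE.
have dlM : dlsubmx M = b^T by rewrite /b trmx_ursub (proj1 psdM).
have ME : M = block_mx s%:M b b^T C by rewrite -ulM -dlM submxK.
rewrite big_split_ord big_ord1 /= -/s.
have CE i : M (rshift 1 i) (rshift 1 i) = C i i by rewrite !mxE.
under eq_bigr do rewrite CE.
have [s_eq|s_ne] := eqVneq s 0.
  have b0 : b = 0.
    by apply: (@psd_zero_corner _ _ _ C); rewrite -(raddf0 (@scalar_mx R 1)) -s_eq -ME.
  by rewrite ME b0 s_eq trmx0 det_ublock det_scalar1 !mul0r lexx.
have s_gt0 : 0 < s by rewrite lt_def s_ne.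
pose P : 'M[R]_(1 + n) := block_mx 1%:M (- s^-1 *: b) 0 1%:M.
pose C' := C - s^-1 *: (b^T *m b).
have PMP : P^T *m M *m P = block_mx s%:M 0 0 C'.
  rewrite ME /P tr_block_mx !trmx1 trmx0 !mulmx_block.
  rewrite !(mul1mx, mulmx1, mul0mx, mulmx0, addr0, add0r).
  rewrite -!(scalemxAl, scalemxAr) !mul_mx_scalar !mul_scalar_mx.
  have -> : (- s^-1 *: b)^T = - s^-1 *: b^T by apply/matrixP => i j; rewrite !mxE.
  rewrite -scalemxAl !scalerA mulrN mulNr mulfV // mulVf // !scaleN1r !addNr.
  by rewrite mul0mx scaler0 add0r scaleNr addrC.
have detM : \det M = s * \det C'.
  have := congr1 (fun N => \det N) PMP; rewrite !det_mulmx det_tr.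
  by rewrite /P !det_ublock !det1 det_scalar1 !(mul1r, mulr1).
have psdC' : psd C'.
  (* A second congruence extracts the lower right block of [P^T M P]. *)
  have := psd_congr (col_mx 0 1%:M) (psd_congr P psdM).
  rewrite PMP tr_col_mx trmx0 trmx1 mul_row_block mul_row_col.
  by rewrite !(mul1mx, mulmx1, mul0mx, mulmx0, addr0, add0r).
have /andP[dC'0 dC'] := IH _ psdC'.
rewrite detM mulr_ge0 //= ler_pM2l // (le_trans dC') //.
apply: ler_prod => i _; rewrite psd_diag_ge0 //= /C' !mxE gerBl.
rewrite mulr_ge0 ?invr_ge0 // big_ord1 mxE -expr2; exact: sqr_ge0.
Qed.

(** * The logarithm inequality and the existence of a water level *)

Lemma ln_prod (R : realType) (n : nat) (x : 'I_n -> R) :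
  (forall i, 0 < x i) -> ln (\prod_i x i) = \sum_i ln (x i).
Proof.
move=> x0; rewrite -[RHS]expRK expR_sum; congr ln.
by apply: eq_bigr => i _; rewrite lnK // posrE.
Qed.

Lemma sum_sub1_ge0 (R : realType) (n : nat) (x : 'I_n -> R) :
  (forall i, 0 < x i) -> 1 <= \prod_i x i -> 0 <= \sum_i (x i - 1).
Proof.
move=> x0 px; apply: (@le_trans _ _ (\sum_i ln (x i))).
  by rewrite -ln_prod // ln_ge0.
apply: ler_sum => i _; have := @le_ln1Dx R (x i - 1).
by rewrite [1 + _]addrC subrK => -> //; rewrite ltrBrDr addNr.
Qed.

Lemma waterlevel_exists (R : realType) (k : nat) (a : 'I_k -> R) (p : R) :
  (0 < k)%N -> (forall i, 0 < a i) -> 0 < p <= 1 ->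
  exists2 eta : R, 0 < eta & \prod_i Num.min 1 (eta / a i) = p.
Proof.
move=> k0 a0 /andP[p0 p1].
pose f (x : R) : R := \prod_i Num.min 1 (x / a i).
have f0 : f 0 = 0.
  by rewrite /f (bigD1 (Ordinal k0)) //= mul0r min_r ?ler01 // mul0r.
(* A level above every [a i], at which all factors of [f] equal 1. *)
pose s := \sum_i a i.
have as_ i : a i <= s.
  by rewrite /s (bigD1 i) //= lerDl sumr_ge0 // => j _; exact: ltW.
have fs : f s = 1.
  by rewrite /f big1 // => i _; rewrite min_l // ler_pdivlMr // mul1r.
have s0 : 0 <= s by rewrite sumr_ge0 // => i _; exact: ltW.
have cf : continuous f.
  apply: continuous_big => [|i _]; first exact: mul_continuous.
  (* Each factor is, up to conversion, the pointwise minimum of a constant map and a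
     multiplication. *)
  move=> x; have : {for x, continuous
      ((cst 1 : R -> R^o) \min ( *%R^~ (a i)^-1 : R -> R^o))}.
    by apply: continuous_min; [exact: cst_continuous | exact: mulrr_continuous].
  by [].
have [|c cs fc] := @IVT R f 0 s p s0 (continuous_subspaceT cf).
  by rewrite f0 fs min_l ?max_r ?ler01 // ltW.
exists c => //; move: cs; rewrite in_itv /= => /andP[c0 _].
(* The level found is nonzero because [f 0 = 0] while [p] is positive. *)
rewrite lt_def c0 andbT; apply: contraTneq p0 => cE.
by rewrite -fc cE f0 ltxx.
Qed.

(** * Families of 2 x 2 blocks and the pairing permutation *)

(** The block diagonal matrix of the [f i], written directly in the ordering (x_1, ..., x_k, v_1,
    ..., v_k). Products and transposes then act block by block, and [Pi] enters only through
    [Pi_mxdiag]. *)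
Definition diagblk (R : realType) (k : nat) (f : 'I_k -> 'M[R]_2) : 'M[R]_(k + k) :=
  block_mx (diag_mx (\row_i f i 0 0)) (diag_mx (\row_i f i 0 1))
           (diag_mx (\row_i f i 1 0)) (diag_mx (\row_i f i 1 1)).

Lemma eq_diagblk (R : realType) (k : nat) (f g : 'I_k -> 'M[R]_2) :
  f =1 g -> diagblk f = diagblk g.
Proof. by move=> fg; congr block_mx; congr diag_mx; apply/rowP => i; rewrite !mxE fg. Qed.

Lemma sum_ord2 (V : nmodType) (F : 'I_2 -> V) : \sum_i F i = F 0 + F 1.
Proof.
by rewrite !big_ord_recl big_ord0 addr0; congr (_ + F _); apply: val_inj.
Qed.

Lemma diagblkM (R : realType) (k : nat) (f g : 'I_k -> 'M[R]_2) :
  diagblk f *m diagblk g = diagblk (fun i => f i *m g i).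
Proof.
rewrite /diagblk mulmx_block !mulmx_diag -!raddfD.
by congr block_mx; congr diag_mx; apply/rowP => i; rewrite !mxE sum_ord2.
Qed.

Lemma tr_diagblk (R : realType) (k : nat) (f : 'I_k -> 'M[R]_2) :
  (diagblk f)^T = diagblk (fun i => (f i)^T).
Proof.
rewrite /diagblk tr_block_mx !tr_diag_mx.
by congr block_mx; congr diag_mx; apply/rowP => i; rewrite !mxE.
Qed.

Lemma mx2E (R : realType) (a b c d : R) :
  [/\ mx2 a b c d 0 0 = a, mx2 a b c d 0 1 = b,
      mx2 a b c d 1 0 = c & mx2 a b c d 1 1 = d].
Proof.
have E0 : (0 : 'I_2) = lshift 1 (0 : 'I_1) by apply: val_inj.
have E1 : (1 : 'I_2) = rshift 1 (0 : 'I_1) by apply: val_inj.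
have sE (x : R) : (x%:M : 'M_1) 0 0 = x by rewrite mxE.
rewrite E0 E1; split; apply: etrans (sE _).
- exact: block_mxEul.
- exact: block_mxEur.
- exact: block_mxEdl.
- exact: block_mxEdr.
Qed.

Lemma mx2M (R : realType) (a b c d a' b' c' d' : R) :
  mx2 a b c d *m mx2 a' b' c' d' =
  mx2 (a * a' + b * c') (a * b' + b * d') (c * a' + d * c') (c * b' + d * d').
Proof.
rewrite /mx2; apply: etrans (@mulmx_block R 1 1 1 1 1 1 _ _ _ _ _ _ _ _) _.
by rewrite -!scalar_mxM -!raddfD.
Qed.

Lemma tr_mx2 (R : realType) (a b c d : R) : (mx2 a b c d)^T = mx2 a c b d.
Proof.
rewrite /mx2; apply: etrans (@tr_block_mx R 1 1 1 1 _ _ _ _) _.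
by rewrite !tr_scalar_mx.
Qed.

Lemma mx2_1 (R : realType) : mx2 1 0 0 1 = 1%:M :> 'M[R]_2.
Proof. by rewrite /mx2 raddf0; apply: esym; exact: (@scalar_mx_block R 1 1 1). Qed.

Lemma diagblk_mx2 (R : realType) (k : nat) (a b c d : 'I_k -> R) :
  diagblk (fun i => mx2 (a i) (b i) (c i) (d i)) =
  block_mx (diag_mx (\row_i a i)) (diag_mx (\row_i b i))
           (diag_mx (\row_i c i)) (diag_mx (\row_i d i)).
Proof.
by congr block_mx; congr diag_mx; apply/rowP => i; rewrite [LHS]mxE [RHS]mxE;
  have [] := mx2E (a i) (b i) (c i) (d i).
Qed.

Lemma diagblk_diag2 (R : realType) (k : nat) (a d : 'I_k -> R) :
  diagblk (fun i => diag2 (a i) (d i)) =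
  diag_mx (row_mx (\row_i a i) (\row_i d i)).
Proof.
rewrite diagblk_mx2 diag_mx_row.
by have -> : diag_mx (\row_(i < k) 0) = 0 :> 'M[R]_k
  by apply/matrixP => i j; rewrite !mxE mul0rn.
Qed.

(** Conjugation by [Pi] renames indices along [unpair]: by injectivity a single term survives in
    each of the two matrix products. *)
Lemma Pi_mxdiag (R : realType) (k : nat) (K : 'I_k -> 'M[R]_2) :
  Pi R k *m (\mxdiag_(i < k) K i) *m (Pi R k)^T = diagblk K.
Proof.
have entry q q' : (Pi R k *m (\mxdiag_(i < k) K i) *m (Pi R k)^T)
    (unpair q) (unpair q') = (\mxdiag_(i < k) K i) q q'.
  rewrite mxE (bigD1 q') //= [X in _ + X]big1 => [|p pq]; last first.
    by rewrite !mxE (inj_eq (@unpair_inj k)) eq_sym (negPf pq) mulr0.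
  rewrite addr0 mxE (bigD1 q) //= [X in _ + X]big1 => [|p pq]; last first.
    by rewrite !mxE (inj_eq (@unpair_inj k)) eq_sym (negPf pq) mul0r.
  by rewrite addr0 [Pi _ _ _ _]mxE [_^T _ _]mxE [Pi _ _ _ _]mxE !eqxx mul1r mulr1.
have diagE i j i' j' : (\mxdiag_(i < k) K i) (tagnat.Rank (p_ := fun=> 2%N) i j)
    (tagnat.Rank (p_ := fun=> 2%N) i' j') = K i j j' *+ (i == i').
  (* [\mxdiag] casts its blocks with [conform_mx], since block sizes may vary in general; here all
     sizes are 2 and the cast is the identity. *)
  have := mxblockK (p_ := fun=> 2%N) (q_ := fun=> 2%N)
     (fun i j => if i == j then conform_mx 0 (K i) else 0) i i'.
  move=> /matrixP/(_ j j'); rewrite mxE => ->.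
  by case: eqP => _; rewrite ?conform_mx_id // mxE.
have lE i : lshift k i = unpair (tagnat.Rank (p_ := fun=> 2%N) i 0).
  by rewrite unpair_Rank.
have rE i : rshift k i = unpair (tagnat.Rank (p_ := fun=> 2%N) i 1).
  by rewrite unpair_Rank.
apply/matrixP => p q.
case: (split_ordP p) => i ->; case: (split_ordP q) => j ->.
- by rewrite block_mxEul !lE entry diagE !mxE.
- by rewrite block_mxEur lE rE entry diagE !mxE.
- by rewrite block_mxEdl lE rE entry diagE !mxE.
- by rewrite block_mxEdr !rE entry diagE !mxE.
Qed.

(** * Spectral decomposition of the 2 x 2 cost block *)

(** With [p] and [q] the entries of the block, the eigenvalues are the roots of [x^2 = p x + q^2].
    Their product [- q^2] is negative, so they have opposite signs. *)
Lemma diagonalizes_exists (R : realType) (sigma tau w b : R) :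
  0 < sigma -> 0 < tau -> 0 < w ->
  exists (Q : 'M[R]_2) (am : R), diagonalizes sigma tau w b Q am.
Proof.
move=> s0 t0 w0; rewrite /diagonalizes /Ablock.
set p := wtilde w b * sigma ^+ 2; set q := w * sigma * tau.
have q0 : 0 < q by rewrite !mulr_gt0.
set ap := aplus sigma tau w b.
set r := Num.sqrt (p ^+ 2 + 4 * q ^+ 2).
have apE : ap = 2^-1 * (p + r).
  by rewrite /ap /aplus -/p /r; congr (_ * (_ + Num.sqrt _)); rewrite /p /q; ring.
clearbody ap p q.
have disc0 : 0 < p ^+ 2 + 4 * q ^+ 2.
  by rewrite ltr_wpDl ?sqr_ge0 // mulr_gt0 // exprn_gt0.
have r2 : r ^+ 2 = p ^+ 2 + 4 * q ^+ 2 by rewrite sqr_sqrtr // ltW.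
have r0 : 0 <= r by exact: sqrtr_ge0.
have rp : `|p| < r.
  rewrite -(@ltr_pXn2r _ 2) ?nnegrE // r2 real_normK ?num_real // ltrDl.
  by rewrite mulr_gt0 // exprn_gt0.
have /andP[rp1 rp2] : - r < p < r by rewrite -ltr_norml.
have ap0 : 0 < ap by rewrite apE; lra.
have char : ap ^+ 2 = p * ap + q ^+ 2.
  by rewrite apE; apply/eqP; rewrite -subr_eq0; apply/eqP; have := r2; lra.
(* The trace of the block is [p], which fixes the second eigenvalue. *)
pose am := p - ap.
have amE : am * ap = - q ^+ 2 by rewrite /am mulrBl -expr2 char; ring.
have am0 : am < 0 by rewrite /am apE; lra.
pose N := Num.sqrt (ap ^+ 2 + q ^+ 2).
have N20 : 0 < ap ^+ 2 + q ^+ 2 by rewrite addr_gt0 ?exprn_gt0.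
have N0 : N != 0 by rewrite gt_eqF // sqrtr_gt0.
have N2 : N ^+ 2 = ap ^+ 2 + q ^+ 2 by rewrite sqr_sqrtr // ltW.
(* The columns are the normalized eigenvectors [(ap, q)] and [(- q, ap)]. *)
pose Q := mx2 (ap / N) (- q / N) (q / N) (ap / N).
have orthQ : orthogonal_mx Q.
  have N21 : ap ^+ 2 / N ^+ 2 + q ^+ 2 / N ^+ 2 = 1.
    by rewrite -mulrDl -N2 mulfV // expf_neq0.
  rewrite /orthogonal_mx tr_mx2 mx2M -mx2_1; congr mx2; rewrite -?expr2 ?expr_div_n.
  - by [].
  - by ring.
  - by ring.
  - by rewrite sqrrN addrC.
exists Q, am; split=> //.
suff AQ : mx2 p q q 0 *m Q = Q *m diag2 ap am.
  by rewrite -mulmxA AQ mulmxA orthQ mul1mx.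
rewrite !mx2M; congr mx2; rewrite ?(mulr0, mul0r, addr0, add0r).
- by rewrite !mulrA -mulrDl [RHS]mulrAC -[q * q]expr2 -char expr2.
- by rewrite /am; ring.
- by ring.
- by rewrite mulrAC [ap * am]mulrC amE; ring.
Qed.

(** * Waterfilling by weak duality *)

(** The right side minus the left is [(c - eta / delta) * (m - delta)]. Either [delta = eta / c] and
    the first factor is zero, or [delta = 1] and both factors are nonpositive. *)
Lemma waterfilling_gap (R : realType) (c eta m : R) : 0 < eta ->
  m <= 1 -> let delta := if 0 < c then Num.min 1 (eta / c) else 1 in
  eta * (m / delta - 1) <= c * (m - delta).
Proof.
move=> eta0 m1 /=; case: ifP => [c0|/negbT]; last first.
  rewrite -leNgt => c0; rewrite divr1 ler_wnM2r ?subr_le0 // (le_trans c0) //.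
  exact: ltW.
rewrite /Num.min; case: ltP => h.
  by rewrite divr1 ler_wnM2r ?subr_le0 //; move: h; rewrite ltr_pdivlMr // mul1r => /ltW.
suff -> : eta * (m / (eta / c) - 1) = c * (m - eta / c) by [].
by field; rewrite ?gt_eqF.
Qed.

(* Weak duality at the multiplier [eta]: the cost of [M] exceeds that of
   [diag delta] by at least [eta * (tr (M / delta) - n)], which [ln x <= x - 1] and
   Hadamard's inequality make nonnegative. *)
Lemma waterfilling_trace (R : realType) (n : nat) (c delta : 'I_n -> R)
    (eta : R) (M : 'M[R]_n) :
  0 < eta -> (forall j, 0 < delta j) ->
  (forall j m, m <= 1 -> eta * (m / delta j - 1) <= c j * (m - delta j)) ->
  psd M -> (forall j, M j j <= 1) -> \prod_j delta j <= \det M ->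
  \sum_j c j * delta j <= \sum_j c j * M j j.
Proof.
move=> eta0 d0 gap psdM M1 detM.
have pd0 : 0 < \prod_j delta j by rewrite prodr_gt0.
have /andP[_ had] := psd_hadamard psdM.
have pM : \prod_j delta j <= \prod_j M j j by exact: le_trans had.
have Mne j : M j j != 0.
  apply: contraTneq (lt_le_trans pd0 pM) => Mj.
  by rewrite (bigD1 j) //= Mj mul0r ltxx.
have Mgt j : 0 < M j j by rewrite lt_def Mne psd_diag_ge0.
rewrite -subr_ge0 -sumrB.
apply: (@le_trans _ _ (\sum_j eta * (M j j / delta j - 1))); last first.
  by apply: ler_sum => j _; rewrite -mulrBr gap.
rewrite -mulr_sumr mulr_ge0 ?(ltW eta0) // sum_sub1_ge0 // => [j|].
  by rewrite divr_gt0.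
by rewrite prodf_div ler_pdivlMr // mul1r.
Qed.

Lemma loewner_diag_le (R : realType) (n : nat) (M N : 'M[R]_n) :
  loewner M N -> forall i, M i i <= N i i.
Proof. by move=> le_MN i; have := psd_diag_ge0 i le_MN; rewrite !mxE subr_ge0. Qed.

(** Turns the extended-real rate constraint into a real one. If [\det K = 0], the left side of the
    first inequality is finite and its right side is -oo, so both inequalities fail. *)
Lemma logdet_leP (R : realType) (n : nat) (S K : 'M[R]_n) (r : R) :
  0 < \det S -> 0 <= \det K ->
  (logdet S - r%:E <= logdet K)%E = (\det S * expR (- r) <= \det K).
Proof.
move=> S0 K0; rewrite /logdet /= [\det S <= 0]leNgt S0 /=.
case: (leP (\det K) 0) => K1 /=.
  have -> : \det K = 0 by apply/eqP; rewrite eq_le K1.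
  by apply/esym/negbTE; rewrite -ltNge mulr_gt0 ?expR_gt0.
by rewrite -EFinB lee_fin -[LHS]ler_expR expRD !lnK.
Qed.

Lemma loewner_congr (R : realType) (m n : nat) (M N : 'M[R]_m) (A : 'M[R]_(m, n)) :
  loewner M N -> loewner (A^T *m M *m A) (A^T *m N *m A).
Proof. by rewrite /loewner -mulmxBl -mulmxBr; exact: psd_congr. Qed.

(** Congruence by [T] and by its inverse translates the constraints on [K] into [0 <= M <= 1] and a
    bound on [\det M], because [T T^T] is the prior covariance. The candidate meets the determinant
    bound with equality. *)
Lemma waterfilling_optimal (R : realType) (k : nat) (B SX SV We : 'M[R]_k)
    (rate eta : R) (T : 'M[R]_(k + k)) (c delta : 'I_(k + k) -> R) :
  T \in unitmx -> T *m T^T = blkdiag SX SV ->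
  T^T *m Wbar B We *m T = diag_mx (\row_j c j) ->
  0 < eta -> (forall j, 0 < delta j <= 1) ->
  (forall j m, m <= 1 -> eta * (m / delta j - 1) <= c j * (m - delta j)) ->
  \prod_j delta j = expR (- (2 * rate)) ->
  optimal B SX SV We rate (T *m diag_mx (\row_j delta j) *m T^T).
Proof.
move=> uT TT TWT eta0 d01 gap pd.
have d0 j : 0 < delta j by have /andP[] := d01 j.
have detT2 : 0 < \det T ^+ 2 by rewrite exprn_even_gt0 // -unitfE -unitmxE.
have detS : \det (blkdiag SX SV) = \det T ^+ 2 by rewrite -TT det_mulmx det_tr.
have S0 : 0 < \det (blkdiag SX SV) by rewrite detS.
(* By cyclicity of the trace, the cost sees only the diagonal of [M]. *)
have cost M : \tr (Wbar B We *m (T *m M *m T^T)) = \sum_j c j * M j j.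
  rewrite !mulmxA mxtrace_mulC !mulmxA TWT mul_diag_mx.
  by apply: eq_bigr => j _; rewrite !mxE.
split.
  have psdK : psd (T *m diag_mx (\row_j delta j) *m T^T).
    rewrite -{1}[T]trmxK; apply: psd_congr; apply: psd_diag_mx => j.
    by rewrite mxE ltW.
  split; first exact: (proj1 psdK).
  - by rewrite /loewner subr0.
  - have le1 : loewner (diag_mx (\row_j delta j)) 1%:M.
      rewrite /loewner -diag_const_mx -raddfB; apply: psd_diag_mx => j.
      by rewrite !mxE subr_ge0; have /andP[] := d01 j.
    by have := loewner_congr T^T le1; rewrite trmxK mulmx1 TT.
  - have /andP[K0 _] := psd_hadamard psdK.
    rewrite logdet_leP // !det_mulmx det_tr det_diag mulrAC -expr2 -detS -pd.
    by under [X in _ <= _ * X]eq_bigr do rewrite mxE.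
move=> K' [_ K'0 K'S K'det].
pose S := invmx T; pose M := S *m K' *m S^T.
have K'E : K' = T *m M *m T^T.
  by rewrite /M !mulmxA mulmxV // mul1mx -mulmxA -trmx_mul mulmxV // trmx1 mulmx1.
have SM : S *m blkdiag SX SV *m S^T = 1%:M.
  by rewrite -TT !mulmxA mulVmx // mul1mx -trmx_mul mulVmx // trmx1.
have psdK' : psd K' by rewrite -[K']subr0.
have psdM : psd M by rewrite /M -{1}[S]trmxK; exact: psd_congr.
rewrite K'E !cost.
under eq_bigr do rewrite !mxE eqxx mulr1n.
apply: (@waterfilling_trace _ _ _ _ eta) => //.
- move=> j; suff /loewner_diag_le/(_ j) : loewner M 1%:M by rewrite !mxE eqxx.
  by have := loewner_congr S^T K'S; rewrite trmxK SM.
(* The factor [\det T ^+ 2] occurs on both sides and cancels. *)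
- have /andP[K'd _] := psd_hadamard psdK'.
  move: K'det; rewrite logdet_leP // -pd detS K'E; clearbody M.
  by rewrite !det_mulmx det_tr [leRHS]mulrAC -expr2 ler_pM2l.
Qed.

(** * Simultaneous diagonalization of the cost matrix *)

Lemma orthogonal_mxV (R : realType) (n : nat) (Q : 'M[R]_n) :
  orthogonal_mx Q -> Q *m Q^T = 1%:M.
Proof. exact: mulmx1C. Qed.

Lemma blkdiagM (R : realType) (m n : nat) (A A' : 'M[R]_m) (D D' : 'M[R]_n) :
  blkdiag A D *m blkdiag A' D' = blkdiag (A *m A') (D *m D').
Proof. by rewrite /blkdiag mulmx_block !(mulmx0, mul0mx, addr0, add0r). Qed.

Lemma tr_blkdiag (R : realType) (m n : nat) (A : 'M[R]_m) (D : 'M[R]_n) :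
  (blkdiag A D)^T = blkdiag A^T D^T.
Proof. by rewrite /blkdiag tr_block_mx !trmx0. Qed.

Lemma orthogonal_blkdiag (R : realType) (m n : nat) (A : 'M[R]_m) (D : 'M[R]_n) :
  orthogonal_mx A -> orthogonal_mx D -> orthogonal_mx (blkdiag A D).
Proof.
rewrite /orthogonal_mx tr_blkdiag blkdiagM => -> ->.
by rewrite /blkdiag -scalar_mx_block.
Qed.

Lemma diagblk1 (R : realType) (k : nat) :
  diagblk (fun=> 1%:M) = 1%:M :> 'M[R]_(k + k).
Proof.
rewrite -mx2_1 (diagblk_diag2 (fun=> 1) (fun=> 1)) -diag_const_mx; congr diag_mx.
by apply/rowP => j; rewrite !mxE; case: splitP => l _; rewrite mxE.
Qed.

(** Conjugation by the orthogonal [U] respects products, so each block of [Wbar] becomes an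
    expression in diagonal matrices; the upper left entries are
    [w (b - 1) + (b - 1) w + w = w (2 b - 1)]. *)
Lemma Wbar_diag (R : realType) (k : nat) (B We U : 'M[R]_k) (b w : 'I_k -> R) :
  orthogonal_mx U ->
  U^T *m B *m U = diag_mx (\row_i b i) ->
  U^T *m We *m U = diag_mx (\row_i w i) ->
  (blkdiag U U)^T *m Wbar B We *m blkdiag U U =
  diagblk (fun i => mx2 (wtilde (w i) (b i)) (w i) (w i) 0).
Proof.
move=> oU dB dW; have UV := orthogonal_mxV oU.
rewrite (diagblk_mx2 _ w w (fun=> 0)) tr_blkdiag /blkdiag /Wbar !mulmx_block.
rewrite !(mulmx0, mul0mx, addr0, add0r) dW.
have -> : diag_mx (\row_(i < k) 0) = 0 :> 'M[R]_k.
  by apply/matrixP => i j; rewrite !mxE mul0rn.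
congr block_mx.
have mulU X Y : U^T *m (X *m Y) *m U = (U^T *m X *m U) *m (U^T *m Y *m U).
  by rewrite !mulmxA -[_ *m U *m U^T]mulmxA UV mulmx1.
have dB1 : U^T *m (B - 1%:M) *m U = diag_mx (\row_i (b i - 1)).
  rewrite mulmxBr mulmxBl dB mulmx1 oU -diag_const_mx -raddfB; congr diag_mx.
  by apply/rowP => i; rewrite !mxE.
have dB1T : U^T *m (B - 1%:M)^T *m U = diag_mx (\row_i (b i - 1)).
  by rewrite -[RHS]tr_diag_mx -dB1 !trmx_mul trmxK mulmxA.
rewrite /Wtilde; move: (B - 1%:M) dB1 dB1T => B1 dB1 dB1T.
rewrite !mulmxDr !mulmxDl !mulU dB1 dB1T dW !mulmx_diag -!raddfD.
by congr diag_mx; apply/rowP => i; rewrite !mxE /wtilde; ring.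
Qed.

Lemma diag2M (R : realType) (a d a' d' : R) :
  diag2 a d *m diag2 a' d' = diag2 (a * a') (d * d').
Proof. by rewrite mx2M !(mulr0, mul0r, addr0, add0r). Qed.

Lemma tr_diag2 (R : realType) (a d : R) : (diag2 a d)^T = diag2 a d.
Proof. exact: tr_mx2. Qed.

(** This is where [A_i] comes from: it is the i-th cost block after the scaling that normalizes both
    prior variances to 1. *)
Lemma Ablock_scaling (R : realType) (sigma tau w b : R) :
  diag2 sigma tau *m mx2 (wtilde w b) w w 0 *m diag2 sigma tau =
  Ablock sigma tau w b.
Proof. by rewrite !mx2M; congr mx2; ring. Qed.

(** * The optimal covariance in paired form *)

Theorem theorem4 (R : realType) (k : nat) (hk : (0 < k)%N)
    (B SigmaX SigmaV We U : 'M[R]_k) (sigma tau b w : 'I_k -> R)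
    (symX : SigmaX^T = SigmaX) (symV : SigmaV^T = SigmaV) (symWe : We^T = We)
    (orthU : orthogonal_mx U)
    (diagX : U^T *m SigmaX *m U = diag_mx (\row_i sigma i ^+ 2))
    (diagV : U^T *m SigmaV *m U = diag_mx (\row_i tau i ^+ 2))
    (diagB : U^T *m B *m U = diag_mx (\row_i b i))
    (diagWe : U^T *m We *m U = diag_mx (\row_i w i))
    (sigma_gt0 : forall i, 0 < sigma i)
    (tau_gt0 : forall i, 0 < tau i)
    (w_gt0 : forall i, 0 < w i) :
  (forall i, exists (Q : 'M[R]_2) (am : R),
     diagonalizes (sigma i) (tau i) (w i) (b i) Q am) /\
  (forall (Rot : 'I_k -> 'M[R]_2) (aminus : 'I_k -> R),
     (forall i,
        diagonalizes (sigma i) (tau i) (w i) (b i) (Rot i) (aminus i)) ->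
   forall rate : R, 0 <= rate ->
   exists (Kstar : 'M[R]_(k + k)) (K Ktilde : 'I_k -> 'M[R]_2)
          (delta : 'I_k -> R) (eta : R),
     optimal B SigmaX SigmaV We rate Kstar /\
     Kstar = blkdiag U U *m Pi R k *m (\mxdiag_(i < k) K i)
               *m (Pi R k)^T *m (blkdiag U U)^T /\
     (forall i, K i = diag2 (sigma i) (tau i) *m Ktilde i
                        *m diag2 (sigma i) (tau i)) /\
     (forall i, Ktilde i = Rot i *m diag2 (delta i) 1 *m (Rot i)^T) /\
     (forall i, 0 < delta i <= 1) /\
     0 < eta /\
     (forall i, delta i =
        Num.min 1 (eta / aplus (sigma i) (tau i) (w i) (b i))) /\
     \sum_(i < k) ln (delta i) = - (2 * rate)).
Proof.
split=> [i|Rot am diagA rate rate0]; first exact: diagonalizes_exists.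
pose a i := aplus (sigma i) (tau i) (w i) (b i).
have a0 i : 0 < a i by have [] := diagA i.
have am0 i : am i < 0 by have [] := diagA i.
(* The condition on the sum of logarithms is handled as a prescribed product; [0 <= rate] keeps that
   product at most 1. *)
have p01 : 0 < expR (- (2 * rate)) <= 1.
  by rewrite expR_gt0 -[leRHS]expR0 ler_expR oppr_le0 mulr_ge0.
have [eta eta0 prod_min] := waterlevel_exists hk a0 p01.
pose delta i := Num.min 1 (eta / a i).
have d01 i : 0 < delta i <= 1.
  by rewrite /delta lt_min ltr01 divr_gt0 //= ge_min lexx.
pose Ub := blkdiag U U; pose D i := diag2 (sigma i) (tau i).
pose T := Ub *m diagblk (fun i => D i *m Rot i).
(* Directions of negative cost [am i] keep their full prior variance, hence the entries 1 in the
   second half. *)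
pose dl (j : 'I_(k + k)) := row_mx (\row_i delta i) (\row_i 1) 0 j.
pose c (j : 'I_(k + k)) := row_mx (\row_i a i) (\row_i am i) 0 j.
have oR i : orthogonal_mx (Rot i) by have [] := diagA i.
have oUb : orthogonal_mx Ub by exact: orthogonal_blkdiag.
have rowE (r : 'rV[R]_(k + k)) : \row_j r 0 j = r.
  by apply/rowP => j; rewrite mxE.
have unitT : T \in unitmx.
  rewrite unitmx_mul; apply/andP; split; first by case: (mulmx1_unit oUb).
  (* An explicit right inverse, block by block. *)
  have : diagblk (fun i => D i *m Rot i) *m
         diagblk (fun i => (Rot i)^T *m diag2 (sigma i)^-1 (tau i)^-1) = 1%:M.
    rewrite diagblkM -diagblk1; apply: eq_diagblk => i.
    rewrite mulmxA -[_ *m Rot i *m _]mulmxA orthogonal_mxV // mulmx1 diag2M.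
    by rewrite !mulfV ?gt_eqF // -mx2_1.
  by case/mulmx1_unit.
have TT : T *m T^T = blkdiag SigmaX SigmaV.
  rewrite /T trmx_mul tr_diagblk mulmxA -[_ *m diagblk _ *m diagblk _]mulmxA diagblkM.
  have -> : diagblk (fun i => D i *m Rot i *m (D i *m Rot i)^T) =
            blkdiag (diag_mx (\row_i sigma i ^+ 2)) (diag_mx (\row_i tau i ^+ 2)).
    rewrite /blkdiag -diag_mx_row -diagblk_diag2; apply: eq_diagblk => i.
    rewrite trmx_mul tr_diag2 mulmxA -[_ *m Rot i *m _]mulmxA orthogonal_mxV //.
    by rewrite mulmx1 diag2M -!expr2.
  have UV := orthogonal_mxV orthU.
  rewrite tr_blkdiag !blkdiagM -diagX -diagV !mulmxA !UV !mul1mx.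
  by rewrite -!mulmxA UV !mulmx1.
have TWT : T^T *m Wbar B We *m T = diag_mx (\row_j c j).
  rewrite rowE /T trmx_mul -!mulmxA [Ub^T *m _]mulmxA [Ub^T *m _ *m _]mulmxA.
  rewrite (Wbar_diag orthU diagB diagWe) tr_diagblk !diagblkM -diagblk_diag2.
  apply: eq_diagblk => i; have [_ <- _ _] := diagA i.
  by rewrite -Ablock_scaling trmx_mul tr_diag2 !mulmxA.
have dl_prod : \prod_j dl j = expR (- (2 * rate)).
  rewrite big_split_ord /= [X in _ * X]big1 => [|i _]; last first.
    by rewrite /dl row_mxEr mxE.
  rewrite mulr1 -prod_min; apply: eq_bigr => i _.
  by rewrite /dl row_mxEl mxE.
have dl01 j : 0 < dl j <= 1.
  rewrite /dl; case: (split_ordP j) => i ->; first by rewrite row_mxEl mxE.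
  by rewrite row_mxEr mxE ltr01 lexx.
(* In the second half the sign of [am i] selects the branch [delta = 1] of [waterfilling_gap]. *)
have gap j m : m <= 1 -> eta * (m / dl j - 1) <= c j * (m - dl j).
  move=> /(waterfilling_gap (c j) eta0) /=.
  rewrite /dl /c; case: (split_ordP j) => i ->.
    by rewrite !row_mxEl !mxE a0.
  by rewrite !row_mxEr !mxE [0 < am i]ltNge (ltW (am0 i)).
exists (T *m diag_mx (\row_j dl j) *m T^T).
exists (fun i => D i *m (Rot i *m diag2 (delta i) 1 *m (Rot i)^T) *m D i).
exists (fun i => Rot i *m diag2 (delta i) 1 *m (Rot i)^T), delta, eta.
split; first exact: (waterfilling_optimal unitT TT TWT eta0 dl01 gap dl_prod).
(* All conjuncts hold by construction except the paired form of the optimum and the sum of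
   logarithms. *)
split; last do 5?[split=> //].
(* Once [Pi] is absorbed into [diagblk], both sides carry the outer factors [Ub] and its transpose,
   and the blocks between them agree one by one. *)
- rewrite rowE -!mulmxA [Pi R k *m _]mulmxA [Pi R k *m _ *m _]mulmxA Pi_mxdiag.
  rewrite -diagblk_diag2 /T trmx_mul tr_diagblk; congr (_ *m _).
  rewrite !mulmxA !diagblkM; congr (_ *m _); apply: eq_diagblk => i.
  by rewrite trmx_mul tr_diag2 !mulmxA.
- rewrite -ln_prod => [|i]; last by have /andP[] := d01 i.
  by rewrite prod_min expRK.
Qed.
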